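(* Let $X$ be a first-countable Tychonoff space. The following are equivalent: (a) $X$ is hemicompact; (b) $C_k(X)$ is metrizable; (c) $(C_k(X), w)$ is Eberlein-Grothendieck.
   Context: All topological spaces are assumed to be Tychonoff and all vector spaces are over $\mathbb{R}$. $C_k(X)$ (resp. $C_p(X)$) is the space $C(X)$ of continuous real-valued functions on $X$ with the compact-open topology (resp. the topology of pointwise convergence). For a locally convex space $E$, $(E,w)$ denotes $E$ with its weak topology $w=\sigma(E,E^{\ast})$, where $E^{\ast}$ is the space of continuous linear functionals on $E$. A topological space $Y$ is Eberlein-Grothendieck if there is a homeomorphic embedding of $Y$ into $C_p(K)$ for some compact space $K$. A space $X$ is hemicompact if there is a sequence $\{K_n : n\in\omega\}$ of compact subsets of $X$ such that every compact $K\subset X$ is contained in some $K_n$. *)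

(* Defs.v *)
From HB Require Import structures.
From mathcomp Require Import all_boot all_order all_algebra.
From mathcomp Require Import all_classical all_reals all_analysis.

Set Implicit Arguments.
Unset Strict Implicit.
Unset Printing Implicit Defensive.

Import Order.TTheory GRing.Theory Num.Theory.
Import numFieldNormedType.Exports.

Local Open Scope classical_set_scope.
Local Open Scope ring_scope.

(* completely_regular_space is phrased with a uniformity separating a point from
   a closed set; by uniform_separatorP this amounts to separation by a continuous
   real-valued function. *)
Definition tychonoff_space (X : topologicalType) : Prop :=
  completely_regular_space X /\ hausdorff_space X.

Definition first_countable (X : topologicalType) : Prop :=
  forall x : X, exists B : nat -> set X,
    (forall n, nbhs x (B n)) /\
    (forall U, nbhs x U -> exists n, B n `<=` U).

Definition hemicompact (X : topologicalType) : Prop :=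
  exists K : nat -> set X,
    (forall n, compact (K n)) /\
    (forall C, compact C -> exists n, C `<=` K n).

(* The last clause says that f is open onto its range with the subspace
   topology, so f is a homeomorphism onto its range. *)
Definition topological_embedding (S T : topologicalType) (f : S -> T) : Prop :=
  [/\ injective f, continuous f &
    forall U : set S, open U ->
      exists2 V : set T, open V & f @` U = V `&` range f].

Definition metrizable (R : realType) (T : topologicalType) : Prop :=
  exists (M : metricType R) (f : T -> M),
    topological_embedding f /\ range f = [set: M].

Section ContinuousFunctions.
Context (X : topologicalType) (R : realType).

Definition Cp : Type := continuousType X R.

HB.instance Definition _ := Choice.on Cp.
HB.instance Definition _ := Topological.copy Cp
  (initial_topology (fun f : continuousType X R => (f : X -> R) : {ptws X -> R})).

Definition Ck : Type := continuousType X R.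

HB.instance Definition _ := Choice.on Ck.
HB.instance Definition _ := Topological.copy Ck
  (initial_topology
     (fun f : continuousType X R => (f : X -> R) : {compact-open, X -> R})).

Implicit Types f g : continuousType X R.

Lemma Ck_add_cts f g : continuous (fun x => f x + g x).
Proof. by move=> x; apply: cvgD; exact: cts_fun. Qed.

Lemma Ck_opp_cts f : continuous (fun x => - f x).
Proof. by move=> x; apply: cvgN; exact: cts_fun. Qed.

Lemma Ck_scale_cts (a : R) f : continuous (fun x => a * f x).
Proof. by move=> x; apply: cvgM; [exact: cvg_cst|exact: cts_fun]. Qed.

Definition Ck_zero : Ck := @cst X R 0.
Definition Ck_add (f g : Ck) : Ck := mkcts (@Ck_add_cts f g).
Definition Ck_opp (f : Ck) : Ck := mkcts (@Ck_opp_cts f).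
Definition Ck_scale (a : R) (f : Ck) : Ck := mkcts (@Ck_scale_cts a f).

Lemma Ck_addA : associative Ck_add.
Proof. by move=> f g h; apply/continuousEP => x; exact: addrA. Qed.

Lemma Ck_addC : commutative Ck_add.
Proof. by move=> f g; apply/continuousEP => x; exact: addrC. Qed.

Lemma Ck_add0 : left_id Ck_zero Ck_add.
Proof. by move=> f; apply/continuousEP => x; exact: add0r. Qed.

Lemma Ck_addN : left_inverse Ck_zero Ck_opp Ck_add.
Proof. by move=> f; apply/continuousEP => x; exact: addNr. Qed.

HB.instance Definition _ :=
  GRing.isZmodule.Build Ck Ck_addA Ck_addC Ck_add0 Ck_addN.

Lemma Ck_scaleA a b (f : Ck) : Ck_scale a (Ck_scale b f) = Ck_scale (a * b) f.
Proof. by apply/continuousEP => x; exact: mulrA. Qed.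

Lemma Ck_scale1 : left_id 1 Ck_scale.
Proof. by move=> f; apply/continuousEP => x; exact: mul1r. Qed.

Lemma Ck_scaleDr : right_distributive Ck_scale +%R.
Proof. by move=> a f g; apply/continuousEP => x; exact: mulrDr. Qed.

Lemma Ck_scaleDl (f : Ck) :
  {morph (fun a => Ck_scale a f) : a b / a + b}.
Proof. by move=> a b; apply/continuousEP => x; exact: mulrDl. Qed.

HB.instance Definition _ := GRing.Zmodule_isLmodule.Build R Ck
  Ck_scaleA Ck_scale1 Ck_scaleDr Ck_scaleDl.

End ContinuousFunctions.

(* Only a vector space with a topology is required here; when E is locally
   convex these are the usual dual and weak topology sigma(E, E^* ). *)
Definition continuous_dual (R : realType) (E : preTopologicalLmodType R) : Type :=
  {phi : {scalar E} | continuous (phi : E -> R)}.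

Definition weak_space (R : realType) (E : preTopologicalLmodType R) : Type := E.

HB.instance Definition _ (R : realType) (E : preTopologicalLmodType R) :=
  Choice.on (weak_space E).
HB.instance Definition _ (R : realType) (E : preTopologicalLmodType R) :=
  Topological.copy (weak_space E)
    (sup_topology (fun phi : continuous_dual E =>
       Topological.class (initial_topology (sval phi : E -> R)))).

Definition eberlein_grothendieck (R : realType) (Y : topologicalType) : Prop :=
  exists K : topologicalType,
    [/\ tychonoff_space K, compact [set: K] &
      exists f : Y -> Cp K R, topological_embedding f].

(* Main.v *)
Require Import Defs.
From HB Require Import structures.
From mathcomp Require Import all_boot all_order all_algebra.
From mathcomp Require Import ring lra.
From mathcomp Require Import all_classical all_reals all_analysis.

Set Implicit Arguments.
Unset Strict Implicit.
Unset Printing Implicit Defensive.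

Import Order.TTheory GRing.Theory Num.Theory.
Import numFieldNormedType.Exports.

Local Open Scope classical_set_scope.
Local Open Scope ring_scope.

(** The three conditions are proved in a cycle.

    If [X] has a cofinal sequence of compact sets [K n], the topology of
    [Ck X R] is given by the countably many seminorms [sup_(K n) |f|], hence
    by one metric ([hemicompact_metrizable]).

    If [Ck X R] is metrizable, then [0] has a countable base of neighbourhoods
    of the form [{f | |f| < d n on L n}].  Their polars are pointwise compact
    by the Banach-Alaoglu argument ([polar_compact]) and together they exhaust
    the dual.  Squeezing the [n]-th polar by the embedding
    [t |-> atan t / (n + 1)] makes these countably many compact sets shrink to
    [0], so that their union with [0] is one compact space, and evaluation on
    it embeds the weak space of [Ck X R]
    ([metrizable_eberlein_grothendieck]).

    Conversely, suppose that the weak space of [Ck X R] embeds in [Cp K R] with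
    [K] compact.  Compactness of the powers of [K] yields countable fan
    tightness in the style of Arhangel'skii: if [0] is in the closure of each
    [A n], finite subsets of the [A n] suffice for [0] to be in the closure of
    their union.  It is applied to sets [A n] of the following kind.  Let [F n]
    be a filter on [X] without cluster points, and let [A n] consist of the
    nonnegative functions equal to [c n] on some member of [F n].  A compact
    set can be separated from some member of [F n], so [0] is in the closure
    of [A n] even for the compact-open topology.  Finitely many elements of
    [A n] are all equal to [c n] on a common member [S n] of [F n], which gives
    [eberlein_grothendieck_selection].

    Suppose first that a point [x] has no compact neighbourhood.  Let [V n] be
    a base of closed neighbourhoods of [x], choose a filter [F n] containing
    [V n] without cluster points, and let [c n = 2 ^ n].  Points [y n] of [S n]
    and [V n] converge to [x], hence [f |-> \sum_n 2 ^ - n * f (y n)] is a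
    continuous functional; it is at least [1] on all selected functions,
    although [0] is in their weak closure, a contradiction.  So [X] is locally compact.  Then the cocompact filter has
    no cluster point, and with [c n = 1] the selection gives compact sets [D n]
    outside which the selected functions are [1].  Testing with the Dirac
    functionals, every point is in some [{f < 1}], an open subset of some
    [D n]; so the finite unions of the [D n] are cofinal among the compact
    sets. *)

(** * Neighbourhoods in function spaces and weak spaces *)

Lemma Ck_ball_nbhs (X : topologicalType) (R : realType) (f : Ck X R)
    (L : set X) (e : R) : compact L -> 0 < e ->
  nbhs f [set g : Ck X R | forall x, L x -> `|g x - f x| < e].
Proof.
move=> cL e0.
have cvgf :
    {family compact, nbhs (f : {compact-open, X -> R}) --> (f : X -> R)}.
  by apply/compact_open_fam_compactP => //; exact: cts_fun.
have /fam_cvgP/(_ L cL) := cvgf.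
pose B := [set g : X -> R | forall x, L x -> `|g x - f x| < e].
move=> /(_ B) cvgB.
suff : nbhs (f : {compact-open, X -> R}) B.
  exact: (@initial_continuous _ _
    (fun h : continuousType X R => (h : X -> R) : {compact-open, X -> R}) f B).
apply: cvgB; apply/uniform_nbhs; exists [set xy | ball xy.1 e xy.2]; split.
  by rewrite -entourage_ballE; exists e.
by move=> h hE x Lx; have := hE x Lx; rewrite /ball/= distrC.
Qed.

(** For continuous real functions the compact-open topology is that of uniform
    convergence on compact sets; a finite union of compact sets being compact,
    one compact set and one radius describe a basic neighbourhood. *)
Lemma Ck_nbhsP (X : topologicalType) (R : realType) (f : Ck X R)
    (U : set (Ck X R)) :
  nbhs f U <-> exists L (e : R), [/\ compact L, 0 < e &
    [set g : Ck X R | forall x, L x -> `|g x - f x| < e] `<=` U].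
Proof.
split; last first.
  by move=> [L [e [cL e0 LU]]]; apply: filterS LU _; exact: Ck_ball_nbhs.
pose B (Le : set X * R) :=
  [set g : X -> R | forall x, Le.1 x -> `|g x - f x| < Le.2].
pose F := filter_from [set Le : set X * R | compact Le.1 /\ 0 < Le.2] B.
have FF : Filter F.
  apply: filter_from_filter.
    by exists (set0, 1); split => //; exact: compact0.
  move=> [L1 e1] [L2 e2] /= [c1 e10] [c2 e20].
  exists (L1 `|` L2, Num.min e1 e2).
    by split; [exact: compactU | rewrite lt_min e10].
  move=> g gB; split=> x Lx; have := gB x; rewrite lt_min => /(_ _)/andP[]//.
    by left.
  by right.
have Ff : {compact-open, F --> (f : X -> R)}.
  apply/compact_open_fam_compactP; first exact: cts_fun.
  apply/fam_cvgP => A cA P /uniform_nbhs [E [entE EP]].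
  move: entE; rewrite -entourage_ballE => -[e e0 eE].
  exists (A, e) => // g gB; apply: EP => x Ax; apply: eE.
  by rewrite /= /ball/= distrC; exact: gB.
move=> [_ [[W oW <-] Wf WU]].
have [[L e] [cL e0] LW] := Ff W (open_nbhs_nbhs (conj oW Wf)).
exists L, e; split => // g gB; apply: WU; exact: LW.
Qed.

Lemma exists_invSn_lt (R : realType) (e : R) :
  0 < e -> exists n, n.+1%:R^-1 < e.
Proof.
move=> e0; have [N _ /(_ N (leqnn N)) NE] := near_infty_natSinv_lt (PosNum e0).
by exists N.
Qed.

Lemma ptws_eval_continuous (I : eqType) (U : topologicalType) (i : I) :
  continuous (fun psi : {ptws I -> U} => psi i : U).
Proof. exact: (@proj_continuous I (fun=> U) i). Qed.

Lemma cvg_ptws (I : Type) (U : topologicalType) (F : set_system {ptws I -> U})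
    (psi : {ptws I -> U}) : Filter F ->
  (forall i V, nbhs (psi i) V -> F [set g | V (g i)]) -> F --> psi.
Proof.
move=> FF Fi; apply/cvg_sup => i A /= [_ [[W oW <-] /= Wpsi] WA].
by apply: filterS WA _; apply: Fi; exact: open_nbhs_nbhs.
Qed.

Lemma continuous_to_ptws (I : Type) (T U : topologicalType)
    (g : T -> {ptws I -> U}) :
  (forall i, continuous (fun t => g t i)) -> continuous g.
Proof. by move=> cg t; apply: cvg_ptws => i V; exact: cg. Qed.

Lemma Cp_eval_continuous (T : topologicalType) (R : realType) (t : T) :
  continuous (fun h : Cp T R => h t).
Proof.
move=> h; apply: (@continuous_comp _ _ _
  (fun g : Cp T R => (g : T -> R) : {ptws T -> R})
  (fun psi : {ptws T -> R} => psi t)).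
  exact: (@initial_continuous (continuousType T R) {ptws T -> R}
    (fun g : continuousType T R => (g : T -> R)) h).
exact: (@ptws_eval_continuous {classic T} R t).
Qed.

Lemma Cp_nbhs (T : topologicalType) (R : realType) (h : Cp T R)
    (V : set (Cp T R)) :
  nbhs h V -> exists (s : seq T) (e : R), 0 < e /\
    [set g : Cp T R | forall t, t \in s -> `|g t - h t| < e] `<=` V.
Proof.
pose B (se : seq T * R) :=
  [set g : T -> R | forall t, t \in se.1 -> `|g t - h t| < se.2].
pose F := filter_from [set se : seq T * R | 0 < se.2] B.
have FF : Filter F.
  apply: filter_from_filter; first by exists ([::], 1) => /=.
  move=> [s1 e1] [s2 e2] /= e10 e20; exists (s1 ++ s2, Num.min e1 e2) => /=.
    by rewrite lt_min e10.
  move=> g gB; split=> t ts; have := gB t;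
    rewrite /= mem_cat ts ?orbT => /(_ isT);
    by rewrite lt_min => /andP[].
have Fh : F --> ((h : T -> R) : {ptws T -> R}).
  apply: cvg_ptws => t A /nbhs_ballP[e /= e0 eA].
  exists ([:: t], e) => // g gB; apply: eA.
  by rewrite /ball/= distrC; apply: gB; rewrite inE.
move=> [_ [[W oW <-] Wh WV]].
have [[s e] e0 sW] := Fh W (open_nbhs_nbhs (conj oW Wh)).
by exists s, e; split => // g gs; apply: WV; exact: sW.
Qed.

Lemma embedding_nbhs (S T : topologicalType) (h : S -> T) (x : S) (U : set S) :
  topological_embedding h -> nbhs x U ->
  exists2 V, nbhs (h x) V & h @^-1` V `<=` U.
Proof.
move=> [hinj _ hopen]; rewrite nbhsE => -[W [oW Wx] WU].
have [V oV hW] := hopen W oW.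
have Vh y : V (h y) -> W y.
  move=> Vy; have : (h @` W) (h y) by rewrite hW; split => //; exists y.
  by move=> [z Wz /hinj <-].
exists V; last by move=> y /Vh; exact: WU.
apply: open_nbhs_nbhs; split => //.
by have : (h @` W) (h x) by [exists x]; rewrite hW => -[].
Qed.

Lemma weak_continuous (R : realType) (E : preTopologicalLmodType R)
    (phi : continuous_dual E) : continuous (sval phi : weak_space E -> R).
Proof.
move=> x V Vx; have xx : nbhs (x : weak_space E) --> (x : weak_space E) by [].
move/cvg_sup : xx => /(_ phi); apply.
exact: (@initial_continuous _ _ (sval phi : E -> R) x V Vx).
Qed.

Lemma continuous_to_weak (R : realType) (E : preTopologicalLmodType R)
    (T : topologicalType) (g : T -> weak_space E) :
  (forall phi : continuous_dual E, continuous (sval phi \o g : T -> R)) ->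
  continuous g.
Proof.
move=> cg t; apply/cvg_sup => phi.
exact: (@continuous_comp_initial _ T R (sval phi : E -> R) g (cg phi)).
Qed.

Definition mkdual (R : realType) (E : preTopologicalLmodType R) (phi : E -> R)
    (phi_lin : forall a f g, phi (a *: f + g) = a * phi f + phi g)
    (phi_cts : continuous phi) : continuous_dual E :=
  exist (fun psi : {scalar E} => continuous (psi : E -> R))
    (HB.pack phi (GRing.isLinear.Build R E R *%R phi phi_lin)) phi_cts.

Lemma strong_to_weak_continuous (X : topologicalType) (R : realType) :
  continuous (id : Ck X R -> weak_space (Ck X R)).
Proof. by apply: continuous_to_weak => phi; exact: (proj2_sig phi). Qed.

(** * Hemicompactness implies metrizability *)

Section ExhaustionMetric.
Context (X : topologicalType) (R : realType) (K : nat -> set X).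
Context (K_cover : forall x, exists n, K n x).

(** Truncating at [1 / (n + 1)] leaves only finitely many [K n] to be
    controlled at a given precision. *)
Definition gap n x (f g : continuousType X R) : R :=
  Num.min n.+1%:R^-1 `|f x - g x|.

(** The point [0] keeps the supremum meaningful when [X] is empty. *)
Definition gaps (f g : continuousType X R) : set R :=
  [set r | r = 0 \/ exists n x, K n x /\ r = gap n x f g].

Definition exhaustion_dist (f g : continuousType X R) : R := sup (gaps f g).

Lemma gaps_has_sup f g : has_sup (gaps f g).
Proof.
split; first by exists 0; left.
exists 1 => r [->//|[n [x [_ ->]]]].
by rewrite /gap ge_min invf_le1 ?ler1n.
Qed.

Lemma gap_le_dist f g n x : K n x -> gap n x f g <= exhaustion_dist f g.
Proof.
move=> Knx; apply: ub_le_sup; first exact: (gaps_has_sup f g).2.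
by right; exists n, x.
Qed.

Lemma dist_le f g b : 0 <= b -> (forall n x, K n x -> gap n x f g <= b) ->
  exhaustion_dist f g <= b.
Proof.
move=> b0 gapb; apply: ge_sup; first exact: (gaps_has_sup f g).1.
by move=> r [->//|[n [x [Knx ->]]]]; exact: gapb.
Qed.

Lemma exhaustion_dist_ge0 f g : 0 <= exhaustion_dist f g.
Proof. by apply: ub_le_sup; [exact: (gaps_has_sup f g).2|left]. Qed.

Lemma exhaustion_distxx f : exhaustion_dist f f = 0.
Proof.
apply/eqP; rewrite eq_le exhaustion_dist_ge0 andbT; apply: dist_le => // n x _.
by rewrite /gap subrr normr0 ge_min lexx orbT.
Qed.

Lemma exhaustion_dist_sym f g : exhaustion_dist f g = exhaustion_dist g f.
Proof.
rewrite /exhaustion_dist; congr sup; apply/funext => r; apply/propext.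
by split=> -[->|[n [x [Knx ->]]]]; [left|right|left|right] => //;
  exists n, x; rewrite /gap distrC.
Qed.

Lemma exhaustion_dist_eq0 f g : exhaustion_dist f g = 0 -> f = g.
Proof.
move=> fg0; apply/continuousEP => x; apply/eqP; rewrite -subr_eq0 -normr_le0.
have [n Knx] := K_cover x.
have := gap_le_dist f g Knx; rewrite fg0 /gap ge_min => /orP[|//].
by rewrite leNgt invr_gt0 ltr0n.
Qed.

Lemma exhaustion_dist_triangle g f h :
  exhaustion_dist f h <= exhaustion_dist f g + exhaustion_dist g h.
Proof.
apply: dist_le => [|n x Knx]; first by rewrite addr_ge0 ?exhaustion_dist_ge0.
apply: le_trans (lerD (gap_le_dist f g Knx) (gap_le_dist g h Knx)).
rewrite /gap; have := ler_distD (g x) (f x) (h x).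
have : (0 : R) < n.+1%:R^-1 by rewrite invr_gt0.
have := normr_ge0 (f x - g x); have := normr_ge0 (g x - h x).
move: `|g x - h x| `|f x - g x| n.+1%:R^-1 `|f x - h x| => b a c d b0 a0 c0 dab.
by rewrite /Num.min; case: (ltP c d); case: (ltP c a); case: (ltP c b); lra.
Qed.

(** The covering hypothesis is recorded in the type because it is what makes
    the distance separate points. *)
Definition exhaustion_space : Type := let _ := K_cover in continuousType X R.

HB.instance Definition _ := Choice.on exhaustion_space.
HB.instance Definition _ := @isMetric.Build R exhaustion_space exhaustion_dist
  exhaustion_distxx exhaustion_dist_eq0 exhaustion_dist_sym
  exhaustion_dist_triangle.

Context (K_compact : forall n, compact (K n)).
Context (K_cofinal : forall C, compact C -> exists n, C `<=` K n).

(** Closeness at distance less than [1 / (n + 1)] is uniform closeness on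
    [K n], since the truncation is then inactive; conversely only the [K i]
    with [1 / (i + 1)] not already small enough impose a condition. *)
Lemma exhaustion_nbhsE (f : continuousType X R) :
  @nbhs _ (Ck X R) f = @nbhs _ exhaustion_space f.
Proof.
apply/seteqP; split=> U.
  move=> /Ck_nbhsP[L [e [cL e0 LU]]].
  have [n Ln] := K_cofinal cL.
  pose d := Num.min e n.+1%:R^-1.
  have d0 : 0 < d by rewrite /d lt_min e0 invr_gt0 ltr0n.
  apply/nbhs_ballP; exists d => // g; rewrite ballEmdist /= => fg.
  apply: LU => x /Ln Knx; rewrite distrC.
  have := le_lt_trans (gap_le_dist f g Knx) fg.
  rewrite /gap /d lt_min !gt_min ltxx /= => /andP[/orP[ne|//] fgn].
  exact: lt_trans fgn ne.
move=> /nbhs_ballP[e /= e0 eU]; apply: filterS eU _.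
have e20 : 0 < e / 2 by rewrite divr_gt0.
have [N Ne] := exists_invSn_lt e20.
apply/Ck_nbhsP; exists (\big[setU/set0]_(i < N.+1) K i), (e / 2); split => //.
  exact: bigsetU_compact.
move=> g fg; rewrite ballEmdist /=.
apply: (@le_lt_trans _ _ (e / 2)); last by rewrite gtr_pMr // invf_lt1 // ltr1n.
apply: dist_le => [|n x Knx]; first exact: ltW.
rewrite /gap ge_min; have [nN|Nn] := leqP n N; apply/orP; [right|left].
  rewrite distrC ltW //; apply: fg; rewrite -bigcup_mkord.
  by exists n.
apply: le_trans (ltW Ne); rewrite lef_pV2 ?posrE ?ltr0n // ler_nat ltnS.
exact: ltnW.
Qed.

Lemma exhaustion_metrizable : metrizable R (Ck X R).
Proof.
exists exhaustion_space, id; split; last first.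
  by apply/seteqP; split => // f _; exists f.
split => //; first by move=> f U; rewrite -exhaustion_nbhsE.
move=> U oU; exists U; last first.
  rewrite image_id; apply/seteqP; split => [f Uf|f []//].
  by split => //; exists f.
rewrite openE => f Uf; rewrite /interior -exhaustion_nbhsE.
exact: open_nbhs_nbhs.
Qed.

End ExhaustionMetric.

Lemma hemicompact_metrizable (X : topologicalType) (R : realType) :
  hemicompact X -> metrizable R (Ck X R).
Proof.
move=> [K [Kc Kcof]]; apply: (@exhaustion_metrizable X R K) => // x.
by have [n xn] := Kcof _ (@compact_set1 _ x); exists n; exact: xn.
Qed.

(** * Polars and compactness *)

(** A filter that does not cluster at [p] lives outside some neighbourhood of
    [p], hence on finitely many of the [C n]. *)
Lemma compact_shrinking_union (T : topologicalType) (p : T) (C : nat -> set T) :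
  (forall n, compact (C n)) ->
  (forall U, nbhs p U -> exists N, forall n, (N <= n)%N -> C n `<=` U) ->
  compact ([set p] `|` \bigcup_n C n).
Proof.
move=> cC Cp F PF FA; have [clp|/existsNP[A]] := pselect (cluster F p).
  by exists p; split => //; left.
move=> /existsNP[U] /not_implyP[Fa] /not_implyP[pU] /set0P/negP/negPn/eqP AU0.
have [N CU] := Cp _ pU.
have cN : compact (\big[setU/set0]_(i < N) C i) by exact: bigsetU_compact.
have [|q [qC clq]] := cN F PF.
  apply: filterS (filterI Fa FA) => x [Ax]; rewrite -bigcup_mkord.
  have nUx : ~ U x by move=> Ux; have : (A `&` U) x by []; rewrite AU0.
  move=> [xp|[n _ Cnx]]; first by case: nUx; rewrite xp; exact: nbhs_singleton.
  exists n => //=; rewrite ltnNge; apply/negP => Nn; apply: nUx.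
  exact: CU Nn _ Cnx.
exists q; split => //; right; move: qC; rewrite -bigcup_mkord => -[n _ Cnq].
by exists n.
Qed.

Lemma set_type_compact (T : topologicalType) (A : set T) :
  compact A -> compact [set: A].
Proof.
move=> cA F PF _.
have FvA : (set_val @ F) A.
  apply: (@filterS _ F _ setT) => [[x xA] _|]; last exact: filterT.
  exact: set_mem xA.
have [p [Ap clp]] := cA _ _ FvA.
exists (SigSub (mem_set Ap)); split => // B U FB.
move=> [_ [[W oW <-] /= Wp WU]].
have FvB : (set_val @ F) (set_val @` B).
  by apply: (@filterS _ F _ B) FB => x Bx; exists x.
have [x [[b Bb <-] Wx]] := clp _ _ FvB (open_nbhs_nbhs (conj oW Wp)).
by exists b; split => //; exact: WU.
Qed.

Lemma set_type_hausdorff (T : topologicalType) (A : set T) :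
  hausdorff_space T -> hausdorff_space (set_type A).
Proof.
move=> hT x y clxy; apply: val_inj; apply: hT => U V Ux Vy.
have [z [Uz Vz]] := clxy _ _ (@initial_continuous _ _ (set_val : A -> T) x U Ux)
  (@initial_continuous _ _ (set_val : A -> T) y V Vy).
by exists (set_val z).
Qed.

Lemma ptws_tychonoff (I : eqType) (R : realType) (A : set {ptws I -> R}) :
  tychonoff_space (set_type A).
Proof.
split; first exact: (@uniform_completely_regular R).
apply: set_type_hausdorff.
exact: (@hausdorff_product I (fun=> R) (fun=> @Rhausdorff R)).
Qed.

Lemma bounded_on_compact (X : topologicalType) (R : realType) (f : Ck X R)
    (L : set X) : compact L ->
  exists2 M : R, 0 < M & forall x, L x -> `|f x| < M.
Proof.
move=> cL; have cfL : compact (f @` L).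
  apply: continuous_compact => //.
  by apply: continuous_subspaceT; exact: cts_fun.
have /ex_strict_bound_gt0 [M M0 fM] := compact_bounded cfL.
by exists M => // x Lx; apply: fM; exists x.
Qed.

Section Polar.
Context (X : topologicalType) (R : realType) (L : set X) (d : R).
Context (L_compact : compact L) (d_gt0 : 0 < d).

(** The polar of [{f | |f| < d on L}] in the algebraic dual; a functional in it
    is automatically continuous by [polar_continuous]. *)
Definition polar : set {ptws Ck X R -> R} :=
  [set phi | (forall a f g, phi (a *: f + g) = a * phi f + phi g) /\
    forall f : Ck X R, (forall x, L x -> `|f x| < d) -> `|phi f| <= 1].

Lemma polar_bound phi (f : Ck X R) M : polar phi -> 0 < M ->
  (forall x, L x -> `|f x| < M * d) -> `|phi f| <= M.
Proof.
move=> [philin phid] M0 fM.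
have phi0 : phi 0 = 0.
  have := philin 1 0 0; rewrite scaler0 addr0 mul1r => /eqP.
  by rewrite -subr_eq0 opprD addrA subrr sub0r oppr_eq0 => /eqP.
have /phid : forall x, L x -> `|(M^-1 *: f) x| < d.
  move=> x Lx; rewrite [X in `|X|](_ : _ = M^-1 * f x)//.
  by rewrite normrM gtr0_norm ?invr_gt0// mulrC ltr_pdivrMr// mulrC fM.
have := philin M^-1 f 0; rewrite addr0 phi0 addr0 => ->.
by rewrite normrM gtr0_norm ?invr_gt0// mulrC ler_pdivrMr// mul1r.
Qed.

Lemma polar_continuous phi : polar phi -> continuous (phi : Ck X R -> R).
Proof.
move=> Pphi f; apply/(@cvgrPdist_le _ _ _ _ (nbhs_filter f)) => e e0.
apply: (@filterS _ _ (nbhs_filter f))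
  (Ck_ball_nbhs f L_compact (mulr_gt0 e0 d_gt0)).
move=> g fg /=.
have -> : phi f - phi g = phi (f - g).
  have := Pphi.1 (-1) g f; rewrite scaleN1r mulN1r => phiE.
  by rewrite (addrC f) phiE addrC.
apply: (polar_bound Pphi e0) => x Lx.
by rewrite distrC; exact: fg.
Qed.

Lemma polar_closed : closed polar.
Proof.
pose lin (p : R * Ck X R * Ck X R) (phi : {ptws Ck X R -> R}) : R :=
  phi (p.1.1 *: p.1.2 + p.2) - (p.1.1 * phi p.1.2 + phi p.2).
pose nrm (f : Ck X R) (phi : {ptws Ck X R -> R}) : R := `|phi f|.
have -> : polar = \bigcap_p (lin p @^-1` [set 0]) `&`
    \bigcap_(f in [set f : Ck X R | forall x, L x -> `|f x| < d])
      (nrm f @^-1` [set x | x <= 1]).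
  apply/seteqP; split=> phi [H1 H2]; split.
  - by move=> [[a f] g] _; rewrite /lin /= H1 subrr.
  - by move=> f fd; exact: H2.
  - move=> a f g; apply/eqP; rewrite -subr_eq0; apply/eqP.
    exact: (H1 (a, f, g)).
  - by move=> f fd; exact: H2.
have evalc f : continuous (fun phi : {ptws Ck X R -> R} => phi f : R).
  exact: (@proj_continuous (Ck X R) (fun=> R) f).
have linc p : continuous (lin p).
  rewrite /lin => phi.
  apply: (@cvgB R R _ (nbhs phi) _
    (fun psi : {ptws Ck X R -> R} => psi (p.1.1 *: p.1.2 + p.2))
    (fun psi : {ptws Ck X R -> R} => p.1.1 * psi p.1.2 + psi p.2)).
    exact: evalc.
  apply: (@cvgD R R _ (nbhs phi) _
    (fun psi : {ptws Ck X R -> R} => p.1.1 * psi p.1.2)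
    (fun psi : {ptws Ck X R -> R} => psi p.2)); last exact: evalc.
  apply: (@cvgMr R _ (nbhs phi) _ (fun psi : {ptws Ck X R -> R} => psi p.1.2)).
  exact: evalc.
have nrmc f : continuous (nrm f).
  move=> phi; apply: (@cvg_norm R R _ (nbhs phi) _
    (fun psi : {ptws Ck X R -> R} => psi f) (phi f)).
  exact: evalc.
apply: closedI; apply: closed_bigI => p _; apply: preimage_closed.
- by move=> phi _; exact: linc.
- exact: closed_eq.
- by move=> phi _; exact: nrmc.
- exact: closed_le.
Qed.

(** Banach-Alaoglu: the polar is a closed subset of a product of segments. *)
Lemma polar_compact : compact polar.
Proof.
have /choice[M HM] (f : Ck X R) : exists M : R,
    0 < M /\ forall x, L x -> `|f x| < M * d.
  have [M M0 fM] := bounded_on_compact f L_compact.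
  exists (M / d); split; first exact: divr_gt0.
  by move=> x Lx; rewrite divfK ?gt_eqF// fM.
apply: (subclosed_compact polar_closed
  (@tychonoff (Ck X R) (fun=> R) (fun f => `[- M f, M f]%classic) _)).
  by move=> f; exact: segment_compact.
move=> phi Pphi f /=; rewrite in_itv /= -ler_norml.
by have [M0 fM] := HM f; exact: (polar_bound Pphi M0).
Qed.

End Polar.

Lemma dirac_in_polar (X : topologicalType) (R : realType) (x : X) :
  polar [set x] 1 (fun f : Ck X R => f x).
Proof. by split=> // f fx; exact: ltW (fx x erefl). Qed.

Lemma weak_polar_nbhs (X : topologicalType) (R : realType)
    (phi : continuous_dual (Ck X R)) :
  @nbhs _ (weak_space (Ck X R)) (0 : Ck X R) [set f | `|sval phi f| < 1].
Proof.
apply: (@filterS _ _ (nbhs_filter ((0 : Ck X R) : weak_space (Ck X R))) _ _ _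
  (@weak_continuous R (Ck X R) phi (0 : Ck X R) _ (nbhsx_ballx _ 1 ltr01))).
by move=> f; rewrite /ball /= (linear0 (sval phi)) sub0r normrN.
Qed.

(** * Metrizability implies the Eberlein-Grothendieck property *)

Lemma metrizable_base (X : topologicalType) (R : realType) :
  metrizable R (Ck X R) -> exists (L : nat -> set X) (d : nat -> R),
    (forall n, compact (L n) /\ 0 < d n) /\
    forall U, nbhs (0 : Ck X R) U ->
      exists n, [set f : Ck X R | forall x, L n x -> `|f x| < d n] `<=` U.
Proof.
move=> [M [h [embh _]]].
have /choice[Ld HLd] (n : nat) : exists Le : set X * R,
    [/\ compact Le.1, 0 < Le.2 &
    [set f : Ck X R | forall x, Le.1 x -> `|f x| < Le.2] `<=`
    h @^-1` ball (h 0) n.+1%:R^-1].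
  have : nbhs (0 : Ck X R) (h @^-1` ball (h 0) n.+1%:R^-1).
    by case: embh => _ ch _; apply: ch; apply: nbhsx_ballx; rewrite invr_gt0.
  move=> /Ck_nbhsP[L [e [cL e0 LU]]]; exists (L, e); split => // f fL.
  by apply: LU => x Lx; rewrite /= [X in `|X|](_ : _ = f x) ?subr0//; exact: fL.
exists (fst \o Ld), (snd \o Ld); split; first by move=> n; have [] := HLd n.
move=> U /(embedding_nbhs embh)[V /nbhs_ballP[e /= e0 eV] VU].
have [n ne] := exists_invSn_lt e0.
exists n; apply: subset_trans VU; have [_ _ nh] := HLd n.
by apply: subset_trans nh _ => f /(le_ball (ltW ne)); exact: eV.
Qed.

Section EberleinGrothendieck.
Context (X : topologicalType) (R : realType).
Context (L : nat -> set X) (d : nat -> R).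
Context (L_compact : forall n, compact (L n)) (d_gt0 : forall n, 0 < d n).
Context (Ld_base : forall U, nbhs (0 : Ck X R) U ->
  exists n, [set f : Ck X R | forall x, L n x -> `|f x| < d n] `<=` U).

(** The factor [1 / (n + 1)] makes the images of the polars shrink to [0]; the
    bounded injection [atan] is what allows this, as the bounds valid on the
    [n]-th polar at a given function may grow faster than [n]. *)
Definition squeeze n (phi : {ptws Ck X R -> R}) : {ptws Ck X R -> R} :=
  fun f => n.+1%:R^-1 * atan (phi f).

Lemma squeeze_continuous n : continuous (squeeze n).
Proof.
apply: continuous_to_ptws => f phi.
apply: (@cvgMr R _ (nbhs phi) _ (fun psi : {ptws Ck X R -> R} => atan (psi f))).
apply: (@continuous_comp _ _ _ (fun psi : {ptws Ck X R -> R} => psi f) atan).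
  exact: ptws_eval_continuous.
exact: continuous_atan.
Qed.

Lemma squeezeK n phi f : tan (n.+1%:R * squeeze n phi f) = phi f.
Proof. by rewrite /squeeze mulrA divff ?pnatr_eq0// mul1r atanK. Qed.

Definition dual_compactum : set {ptws Ck X R -> R} :=
  [set (fun=> 0)] `|` \bigcup_n (squeeze n @` polar (L n) (d n)).

Lemma dual_compactum_compact : compact dual_compactum.
Proof.
apply: compact_shrinking_union => [n|U U0].
  apply: continuous_compact; last exact: polar_compact.
  by apply: continuous_subspaceT; exact: squeeze_continuous.
pose tails := filter_from [set: nat]
  (fun N => \bigcup_(n in [set n | (N <= n)%N])
    (squeeze n @` polar (L n) (d n))).
have Ft : Filter tails.
  apply: filter_from_filter; first by exists 0%N.
  move=> i j _ _; exists (maxn i j) => // psi [n /= ijn psin].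
  by move: ijn; rewrite geq_max => /andP[ni nj]; split; exists n.
have tails0 : tails --> (((fun=> 0) : Ck X R -> R) : {ptws Ck X R -> R}).
  apply: cvg_ptws => f V /nbhs_ballP[e /= e0 eV].
  have [N Ne] := exists_invSn_lt (divr_gt0 e0 (pi_gt0 R)).
  exists N => // _ [n Nn [phi _ <-]]; apply: eV.
  rewrite /ball/= sub0r normrN /squeeze normrM gtr0_norm ?invr_gt0//.
  have atanpi : `|atan (phi f)| <= pi.
    rewrite ler_norml; have := atan_ltpi2 (phi f); have := atan_gtNpi2 (phi f).
    by have := pi_gt0 R; lra.
  apply: (@le_lt_trans _ _ (N.+1%:R^-1 * pi)); last first.
    by rewrite -ltr_pdivlMr// pi_gt0.
  by apply: ler_pM => //; rewrite lef_pV2 ?posrE ?ltr0n// ler_nat ltnS.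
have [N _ NU] := tails0 U U0.
by exists N => n Nn psi psin; apply: NU; exists n.
Qed.

Lemma dual_compactum_eval_cts (f : Ck X R) :
  continuous (fun k : dual_compactum => set_val k f : R).
Proof.
move=> k; apply: (@continuous_comp _ _ _
  (set_val : dual_compactum -> {ptws Ck X R -> R})
  (fun psi : {ptws Ck X R -> R} => psi f)); first exact: initial_continuous.
exact: ptws_eval_continuous.
Qed.

Definition evaluation (f : weak_space (Ck X R)) : Cp dual_compactum R :=
  mkcts (@dual_compactum_eval_cts f).

Lemma evaluation_continuous : continuous evaluation.
Proof.
apply: (@continuous_comp_initial _ _ {ptws dual_compactum -> R}
  (fun f : continuousType dual_compactum R => (f : dual_compactum -> R))).
apply: continuous_to_ptws => k f.
have [kz|[n _ [phi Pphi kphi]]] := set_valP k.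
  rewrite [X in continuous_at _ X](_ : _ = cst 0).
    exact: (@cst_continuous (weak_space (Ck X R)) R 0 f).
  by apply/funext => g; rewrite -[LHS]/(set_val k g) set_valE kz.
rewrite [X in continuous_at _ X](_ : _ =
    fun g : weak_space (Ck X R) => squeeze n phi g); last first.
  by apply/funext => g; rewrite -[LHS]/(set_val k g) set_valE -kphi.
apply: (@cvgMr R _ (nbhs f) _ (fun g : weak_space (Ck X R) => atan (phi g))).
apply: (@continuous_comp _ _ _ (phi : weak_space (Ck X R) -> R) atan).
  have := @weak_continuous R (Ck X R) (mkdual Pphi.1
    (polar_continuous (@L_compact n) (d_gt0 n) Pphi)) f.
  exact.
exact: continuous_atan.
Qed.

Lemma dual_in_polar (phi : continuous_dual (Ck X R)) :
  exists n, polar (L n) (d n) (sval phi).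
Proof.
case: phi => phi phic /=.
have : nbhs (0 : Ck X R) (phi @^-1` ball (phi 0) 1).
  by apply: phic; exact: nbhsx_ballx.
move=> /Ld_base[n Ln]; exists n; split; first by move=> a f g; rewrite linearP.
move=> f /Ln; rewrite /ball/= linear0 sub0r normrN; exact: ltW.
Qed.

(** Each continuous functional is recovered from one coordinate of [evaluation]
    through [tan]; the second conclusion says that [tan] is continuous at the
    values it is applied to. *)
Lemma dual_factor (phi : continuous_dual (Ck X R)) :
  exists n k, forall f : Ck X R, sval phi f = tan (n.+1%:R * evaluation f k) /\
    cos (n.+1%:R * evaluation f k) != 0.
Proof.
have [n Pphi] := dual_in_polar phi.
have Kphi : dual_compactum (squeeze n (sval phi)).
  by right; exists n => //; exists (sval phi : Ck X R -> R).
exists n, (SigSub (mem_set Kphi)) => f.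
rewrite /evaluation /= squeezeK; split => //.
rewrite /squeeze mulrA divff ?pnatr_eq0// mul1r gt_eqF//.
by rewrite cos_gt0_pihalf// atan_gtNpi2 atan_ltpi2.
Qed.

Lemma evaluation_inj : injective evaluation.
Proof.
move=> f g fg; apply/continuousEP => x.
have Px := @dirac_in_polar X R x.
have [n [k phik]] := dual_factor (mkdual Px.1
  (polar_continuous (@compact_set1 X x) ltr01 Px)).
by have := (phik f).1; rewrite fg -(phik g).1.
Qed.

(** It suffices that the initial topology of [evaluation] makes all continuous
    functionals continuous, which [dual_factor] provides. *)
Lemma evaluation_embedding : topological_embedding evaluation.
Proof.
split; [exact: evaluation_inj|exact: evaluation_continuous|].
have weak_coarser : continuous
    (id : initial_topology evaluation -> weak_space (Ck X R)).
  apply: continuous_to_weak => phi f.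
  have [n [k phik]] := dual_factor phi.
  rewrite [X in continuous_at _ X](_ : _ =
    fun g => tan (n.+1%:R * evaluation g k)); last first.
    by apply/funext => g; exact: (phik g).1.
  apply: (@continuous_comp _ _ _
    (fun g : initial_topology evaluation => n.+1%:R * evaluation g k) tan);
    last first.
    by apply: continuous_tan; exact: (phik f).2.
  apply: (@cvgMr R _ (nbhs f) _ (fun g => evaluation g k)).
  apply: (@continuous_comp _ _ _ (evaluation : initial_topology evaluation -> _)
    (fun h : Cp dual_compactum R => h k)); last exact: Cp_eval_continuous.
  exact: initial_continuous.
move=> U oU.
have : open ((id : initial_topology evaluation -> weak_space (Ck X R)) @^-1` U).
  by apply: open_comp => // f _; exact: weak_coarser.
move=> [V oV VU]; exists V => //.
have UV f : U f = V (evaluation f).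
  by rewrite -[RHS]/((evaluation @^-1` V) f) VU.
apply/seteqP; split=> [_ [f Uf <-]|h [Vh [f _ fh]]].
  by split; [rewrite -UV|exists f].
by exists f => //; rewrite UV fh.
Qed.

End EberleinGrothendieck.

Lemma metrizable_eberlein_grothendieck (X : topologicalType) (R : realType) :
  metrizable R (Ck X R) -> eberlein_grothendieck R (weak_space (Ck X R)).
Proof.
move=> /metrizable_base[L [d [Ld Ld_base]]].
have cL n := (Ld n).1; have d0 n := (Ld n).2.
exists (dual_compactum L d); split.
- exact: ptws_tychonoff.
- apply: set_type_compact; exact: dual_compactum_compact.
- by exists (@evaluation X R L d); exact: evaluation_embedding.
Qed.

(** * The selection principle *)

(** Every point of [L] has a function vanishing at it and equal to [1] on a
    member of [F].  Such functions are stable under finite minima, so by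
    compactness one of them is below [1 / 2] on all of [L]; rescaling and
    truncating it gives [f]. *)
Lemma separate_compact_filter (X : topologicalType) (R : realType)
    (F : set_system X) (L : set X) (c : R) :
  completely_regular_space X -> Filter F -> compact L ->
  (forall p, L p -> ~ cluster F p) -> 0 <= c ->
  exists2 f : Ck X R, (forall x, 0 <= f x) /\ (forall x, L x -> f x = 0) &
    exists2 S, F S & forall x, S x -> f x = c.
Proof.
move=> crX FF cL Fcl c0.
pose B := [set g : Ck X R | exists2 S, F S & forall x, S x -> g x = 1].
(* eventually along [G] means: for all small enough elements of [B] *)
pose G := filter_from B (fun g0 => [set g | B g /\ forall x, g x <= g0 x]).
have FG : Filter G.
  apply: filter_from_filter.
    by exists (@cst X R 1); exists setT => //; exact: filterT.
  move=> g h [S FS gS] [T FT hT].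
  have minc : continuous (fun x => Num.min (g x) (h x)).
    by move=> x; apply: continuous_min; exact: cts_fun.
  exists (mkcts minc : Ck X R).
    exists (S `&` T); first exact: filterI.
    by move=> x [Sx Tx]; rewrite /= /mkcts /= gS// hT// minxx.
  by move=> k [Bk kgh]; split; split => // x; have := kgh x;
    rewrite /= /mkcts /= le_min => /andP[].
pose P (g : Ck X R) y := g y < 1 / 2.
have : \forall g \near G, L `<=` P g.
  apply: ((compact_near_coveringP L).1 cL) => p Lp.
  have /existsNP[A /existsNP[U /not_implyP[FA /not_implyP[pU AU]]]] := Fcl p Lp.
  have npA : ~ closure A p by move=> /(_ U pU) /AU.
  have /(uniform_separatorP (R := R)) := crX p _ (@closed_closure _ A) npA.
  move=> [g [cg _ gp gA]].
  exists ([set y | g y < 1 / 2],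
    [set h : Ck X R | B h /\ forall x, h x <= g x]).
    split => /=.
      have gp12 : g p < 1 / 2 by rewrite (gp (g p)) ?divr_gt0//; exists p.
      exact: (cg p _ (open_nbhs_nbhs (conj (@open_lt R (1 / 2)) gp12))).
    exists (mkcts cg : Ck X R) => //; exists A => // x Ax.
    by apply: gA; exists x => //; exact: subset_closure.
  by move=> [y h] /= [gy [_ hg]]; exact: le_lt_trans (hg y) gy.
move=> [g Bg gL].
have {}gL x : L x -> g x < 1 / 2 by apply: (gL g).
have [S FS gS] := Bg.
have hc : continuous (fun x => 2 * g x - 1).
  by move=> x; apply: cvgB; [apply: cvgMr; exact: cts_fun|exact: cvg_cst].
have mc : continuous (fun x => Num.max 0 (2 * g x - 1)).
  by move=> x; apply: (@continuous_max _ _ (cst 0) (fun x => 2 * g x - 1));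
    [exact: cvg_cst|exact: hc].
have fc : continuous (fun x => c * Num.max 0 (2 * g x - 1)).
  by move=> x; apply: cvgMr; exact: mc.
exists (mkcts fc : Ck X R); first split => x; rewrite /= /mkcts /=.
- by rewrite mulr_ge0// le_max lexx.
- move=> /gL gx; rewrite (max_idPl _) ?mulr0//; lra.
exists S => // x Sx; rewrite /= /mkcts /= gS// (max_idPr _); lra.
Qed.

(** For fixed [n], each sequence [s] in [K] has a function [f], equal to [c n]
    on a member of [F n], with [j f] close to [j 0] at the first [n] terms of
    [s]; the same [f] serves the sequences near [s].  By compactness of the
    space of all sequences in [K] one member [S n] of [F n] works for all [s].
    A basic neighbourhood of [j 0] involves finitely many points of [K], which
    are the first terms of some sequence. *)
Lemma eberlein_grothendieck_selection (X : topologicalType) (R : realType)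
    (K : topologicalType) (j : weak_space (Ck X R) -> Cp K R)
    (F : nat -> set_system X) (c : nat -> R) (k0 : K) :
  completely_regular_space X -> compact [set: K] -> topological_embedding j ->
  (forall n, ProperFilter (F n)) -> (forall n p, ~ cluster (F n) p) ->
  (forall n, 0 <= c n) ->
  exists2 S : nat -> set X, (forall n, F n (S n)) &
    forall W : set (weak_space (Ck X R)),
      @nbhs _ (weak_space (Ck X R)) (0 : Ck X R) W ->
      exists n (f : Ck X R), [/\ W f, forall x, 0 <= f x &
        forall x, S n x -> f x = c n].
Proof.
move=> crX cK embj PF Fcl c0.
have jc : continuous j by case: embj.
pose close n (s : nat -> K) (f : Ck X R) :=
  forall i : 'I_n, `|j f (s i) - j 0 (s i)| < n.+1%:R^-1.
have cKN : compact [set: {ptws nat -> K}].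
  have := @tychonoff nat (fun=> K) (fun=> setT) (fun=> cK).
  by congr compact; apply/seteqP; split.
have /choice[S HS] (n : nat) : exists S, F n S /\ forall s, exists f : Ck X R,
    [/\ close n s f, forall x, 0 <= f x & forall x, S x -> f x = c n].
  pose P S (s : {ptws nat -> K}) := exists f : Ck X R,
    [/\ close n s f, forall x, 0 <= f x & forall x, S x -> f x = c n].
  have : \forall S \near powerset_filter_from (F n),
      [set: {ptws nat -> K}] `<=` P S.
    apply: ((compact_near_coveringP _).1 cKN) => s _.
    have close0 : @nbhs _ (weak_space (Ck X R)) (0 : Ck X R) (close n s).
      apply: (@filter_forall _ 'I_n (fun i (f : weak_space (Ck X R)) =>
        `|j f (s i) - j 0 (s i)| < n.+1%:R^-1) _ (nbhs_filter _)) => i.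
      have jic : continuous (fun f : weak_space (Ck X R) => j f (s i)).
        move=> f; apply: (@continuous_comp _ _ _ j (fun h : Cp K R => h (s i))).
          exact: jc.
        exact: Cp_eval_continuous.
      have n0 : (0 : R) < n.+1%:R^-1 by rewrite invr_gt0.
      apply: (@filterS _ _ (nbhs_filter (0 : weak_space (Ck X R))) _ _ _
        (jic 0 _ (nbhsx_ballx (j 0 (s i)) _ n0))) => f.
      by rewrite /ball/= distrC.
    have /Ck_nbhsP[L [e [cL e0 LU]]] := strong_to_weak_continuous close0.
    have [f [f0 fL] [T FT fT]] := separate_compact_filter crX
      (@filter_filter _ _ (PF n)) cL (fun p _ => Fcl n p) (c0 n).
    have fs : close n s f.
      apply: LU => x Lx /=.
      by rewrite fL// [X in `|X|](_ : _ = 0) ?normr0// subr0.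
    have fs' : \forall s' \near s, close n s' f.
      apply: (@filter_forall _ 'I_n (fun i (s' : {ptws nat -> K}) =>
        `|j f (s' i) - j 0 (s' i)| < n.+1%:R^-1) _ (nbhs_filter _)) => i.
      have jfc (h : Cp K R) :
          {for s, continuous (fun s' : {ptws nat -> K} => h (s' i))}.
        apply: (@continuous_comp _ _ _ (fun s' : {ptws nat -> K} => s' i) h).
          exact: ptws_eval_continuous.
        exact: cts_fun.
      have cvgj := @cvg_norm R R _ _ (nbhs_filter s) _ _
        (@cvgB R R _ _ (nbhs_filter s) _ _ _ _ (jfc (j f)) (jfc (j 0))).
      exact: (@cvgr_lt _ _ _ (nbhs_filter s) _ _ cvgj _ (fs i)).
    exists ([set s' | close n s' f], [set S | S `<=` T]).
      by split => //=; exact: small_set_sub.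
    move=> [s' S] /= [fs'' ST]; exists f; split => // x /ST; exact: fT.
  move=> nearS; near (powerset_filter_from (F n)) => S.
  exists S; split; first by near: S; exact: near_small_set.
  have PS : [set: {ptws nat -> K}] `<=` P S by near: S.
  by move=> s; exact: (PS s I).
exists S => [n|W]; first exact: (HS n).1.
move=> /(embedding_nbhs embj)[V /Cp_nbhs[s [e [e0 sV]]] VW].
have [m me] := exists_invSn_lt e0.
pose n := maxn m (size s).
have [f [fs f0 fS]] := (HS n).2 (nth k0 s).
exists n, f; split => //; apply/VW/sV => t ts.
have tn : (index t s < n)%N by rewrite (leq_trans _ (leq_maxr _ _))// index_mem.
have := fs (Ordinal tn); rewrite /= nth_index// => /lt_le_trans; apply.
apply: le_trans (ltW me); rewrite lef_pV2 ?posrE ?ltr0n// ler_nat ltnS.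
exact: leq_maxl.
Unshelve. all: by end_near. Qed.

(** * The Eberlein-Grothendieck property implies hemicompactness *)

Section DyadicSum.
Context (X : topologicalType) (R : realType) (L : set X) (x : nat -> X).
Context (L_compact : compact L) (xL : forall n, L (x n)).

Definition dyadic_terms (f : Ck X R) : R ^nat := fun n => 2^-1 ^+ n * f (x n).

Definition dyadic_sum (f : Ck X R) : R := limn (series (dyadic_terms f)).

Lemma dyadic_terms_le (f : Ck X R) M n : (forall y, L y -> `|f y| <= M) ->
  `|dyadic_terms f n| <= geometric M 2^-1 n.
Proof.
move=> fM; have w0 : (0 : R) <= 2^-1 ^+ n by rewrite exprn_ge0// invr_ge0.
by rewrite /dyadic_terms /= normrM (ger0_norm w0) [leRHS]mulrC ler_wpM2l// fM.
Qed.

Let half_lt1 : `|2^-1 : R| < 1.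
Proof. by rewrite ger0_norm ?invr_ge0// invf_lt1// ltr1n. Qed.

Lemma dyadic_norm_cvg (f : Ck X R) M :
  0 <= M -> (forall y, L y -> `|f y| <= M) ->
  cvgn [normed series (dyadic_terms f)].
Proof.
move=> M0 fM; apply: (@series_le_cvg _ _ (geometric M 2^-1)).
- by move=> n /=; exact: normr_ge0.
- by move=> n /=; rewrite mulr_ge0// exprn_ge0// invr_ge0.
- by move=> n; exact: dyadic_terms_le.
- exact: is_cvg_geometric_series.
Qed.

Lemma dyadic_cvg (f : Ck X R) : cvgn (series (dyadic_terms f)).
Proof.
have [M M0 fM] := bounded_on_compact f L_compact.
by apply: normed_cvg; apply: (@dyadic_norm_cvg f M (ltW M0)) => y /fM /ltW.
Qed.

(** [1 / 2] is chosen because the weights [2 ^ - n] add up to [2]. *)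
Lemma dyadic_sum_polar : polar L 2^-1 dyadic_sum.
Proof.
split=> [a f g|f fL].
  have -> : dyadic_sum (a *: f + g) =
      limn (series (a *: dyadic_terms f + dyadic_terms g)).
    congr (limn (series _)); apply/funext => n; rewrite /dyadic_terms /=.
    rewrite [X in _ * X](_ : _ = a * f (x n) + g (x n))//.
    by rewrite mulrDr mulrCA.
  rewrite lim_seriesD; [|exact/is_cvg_seriesZ/dyadic_cvg|exact: dyadic_cvg].
  by rewrite lim_seriesZ//; exact: dyadic_cvg.
have fL' y : L y -> `|f y| <= 2^-1 by move=> /fL /ltW.
have nc := dyadic_norm_cvg (ltac:(by rewrite invr_ge0) : 0 <= 2^-1 :> R) fL'.
apply: (le_trans (lim_series_norm nc)).
have /cvg_lim gl := @cvg_geometric_series R 2^-1 2^-1 half_lt1.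
have <- : limn (series (geometric (2^-1 : R) 2^-1)) = 1.
  by rewrite gl//; field.
apply: lim_series_le => //; first exact: is_cvg_geometric_series.
by move=> n; exact: dyadic_terms_le.
Qed.

Lemma dyadic_sum_ge1 (f : Ck X R) n :
  (forall y, 0 <= f y) -> f (x n) = 2 ^+ n ->
  1 <= dyadic_sum f.
Proof.
move=> f0 fxn.
have t0 k : 0 <= dyadic_terms f k.
  by rewrite mulr_ge0// exprn_ge0// invr_ge0.
have ndt : {homo series (dyadic_terms f) : n m / (n <= m)%N >-> n <= m}.
  by apply: nondecreasing_series => k _ _; exact: t0.
apply: le_trans (nondecreasing_cvgn_le ndt (@dyadic_cvg f) n.+1).
have t1 : dyadic_terms f n = 1.
  by rewrite /dyadic_terms fxn -exprMn mulVf ?pnatr_eq0// expr1n.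
by rewrite seriesSr t1 lerDr seriesEnat /= sumr_ge0.
Qed.

End DyadicSum.

Lemma noncompact_free_filter (T : topologicalType) (V : set T) :
  closed V -> ~ compact V ->
  exists F : set_system T, [/\ ProperFilter F, F V & forall p, ~ cluster F p].
Proof.
move=> cV /existsNP[F /existsNP[PF /not_implyP[FV clF]]].
exists F; split => // p Fp; apply: clF; exists p; split => //.
by apply: cV => U Up; exact: Fp.
Qed.

Section HemicompactOfEmbedding.
Context (X : topologicalType) (R : realType) (K : topologicalType).
Context (j : weak_space (Ck X R) -> Cp K R) (k0 : K).
Context (crX : completely_regular_space X) (fcX : first_countable X).
Context (K_compact : compact [set: K]) (j_emb : topological_embedding j).

(** Around a point [x] without compact neighbourhood, the selection with
    constants [2 ^ n] gives points [y n] converging to [x] where the [n]-th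
    functions equal [2 ^ n]: the functional [dyadic_sum] is then at least [1]
    on all of them, although [0] is in their weak closure. *)
Lemma first_countable_compact_nbhs (x : X) : exists2 C, compact C & nbhs x C.
Proof.
apply: contrapT => noC.
have [B [nB Bbase]] := fcX x.
have /choice[V HV] (n : nat) : exists V : set X,
    [/\ nbhs x V, closed V & forall i, (i <= n)%N -> V `<=` B i].
  have nBn : nbhs x [set y | forall i : 'I_n.+1, B i y].
    by apply: filter_forall => i; exact: nB.
  have [U xU UB] := @completely_regular_regular R X crX x _ nBn.
  exists (closure U); split; last 1 first.
  - by move=> i; rewrite -ltnS => ilt y /UB /(_ (Ordinal ilt)).
  - by apply: filterS xU; exact: subset_closure.
  - exact: closed_closure.
have nV n : nbhs x (V n) by have [] := HV n.
have /choice[F HF] (n : nat) : exists F : set_system X,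
    [/\ ProperFilter F, F (V n) & forall p, ~ cluster F p].
  have [nVn cVn _] := HV n.
  by apply: noncompact_free_filter => // coV; apply: noC; exists (V n).
have c0 n : (0 : R) <= 2 ^+ n by rewrite exprn_ge0.
have [S FS SW] := eberlein_grothendieck_selection k0 crX K_compact j_emb
  (fun n => let: And3 h _ _ := HF n in h)
  (fun n => let: And3 _ _ h := HF n in h) c0.
have /choice[y Hy] (n : nat) : exists y, S n y /\ V n y.
  have [PF FV _] := HF n.
  by have [y [Sy Vy]] := filter_ex (filterI (FS n) FV); exists y.
have cL : compact ([set x] `|` \bigcup_n [set y n]).
  apply: compact_shrinking_union => [n|U /Bbase[N BN]].
    exact: compact_set1.
  exists N => n Nn z ->; apply: BN; have [_ _] := HV n; apply => //.
  exact: (Hy n).2.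
have yL n : ([set x] `|` \bigcup_n [set y n]) (y n) by right; exists n.
have Pnu := @dyadic_sum_polar X R _ y cL yL.
have half0 : (0 : R) < 2^-1 by rewrite invr_gt0.
pose nu := mkdual Pnu.1 (polar_continuous cL half0 Pnu).
have nuW : @nbhs _ (weak_space (Ck X R)) (0 : Ck X R)
    [set f | `|sval nu f| < 1].
  exact: weak_polar_nbhs.
have [n [f [/= nuf f0 fS]]] := SW _ nuW.
have := @dyadic_sum_ge1 X R _ y cL yL f n f0 (fS _ (Hy n).1).
by rewrite leNgt (le_lt_trans (ler_norm _) nuf).
Qed.

Definition cocompact : set_system X :=
  [set S | exists2 C, compact C & ~` C `<=` S].

(** The selection for the cocompact filter with constants [1], tested against
    Dirac functionals, covers [X] by open sets [{f < 1}] contained in the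
    compact sets [D n]. *)
Lemma hemicompact_of_embedding : hemicompact X.
Proof.
have [cX|ncX] := pselect (compact [set: X]).
  by exists (fun=> setT); split => // C _; exists 0%N.
have PF : ProperFilter cocompact.
  split.
    move=> [C cC C0]; apply: ncX; suff <- : C = setT by [].
    by apply/seteqP; split => // x _; apply: contrapT => /C0.
  split.
  - by exists set0; [exact: compact0|].
  - move=> P Q [C cC CP] [D cD DQ]; exists (C `|` D); first exact: compactU.
    by rewrite setCU => x [/CP ? /DQ].
  - by move=> P Q PQ [C cC CP]; exists C => //; exact: subset_trans PQ.
have cocl p : ~ cluster cocompact p.
  have [C cC pC] := first_countable_compact_nbhs p => clp.
  have Cn : cocompact (~` C) by exists C.
  by have [x [nCx Cx]] := clp _ _ Cn pC.
have [S FS SW] := eberlein_grothendieck_selection k0 crX K_compact j_emb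
  (fun=> PF) (fun=> cocl) (fun=> ler01).
have /choice[D HD] n : exists C, compact C /\ ~` C `<=` S n.
  by have [C cC CS] := FS n; exists C.
exists (fun n => \big[setU/set0]_(i < n.+1) D i); split.
  by move=> n; apply: bigsetU_compact => i _; exact: (HD i).1.
move=> C cC.
have : \forall n \near \oo,
    C `<=` (fun y => (\big[setU/set0]_(i < n.+1) D i) y).
  apply: ((compact_near_coveringP C).1 cC) => p Cp.
  have Pd := @dirac_in_polar X R p.
  pose delta := mkdual Pd.1 (polar_continuous (@compact_set1 X p) ltr01 Pd).
  have deltaW : @nbhs _ (weak_space (Ck X R)) (0 : Ck X R)
      [set f | `|sval delta f| < 1].
    exact: weak_polar_nbhs.
  have [n [f [/= fp f0 fS]]] := SW _ deltaW.
  exists ([set y | f y < 1], [set m | (n <= m)%N]).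
    split => /=; last by exists n.
    have fp1 : f p < 1 by exact: le_lt_trans (ler_norm _) fp.
    exact: (cts_fun _ _ (open_nbhs_nbhs (conj (@open_lt R 1) fp1))).
  move=> [y m] /= [fy nm]; rewrite -bigcup_mkord; exists n => //=.
  by apply: contrapT => /(HD n).2 /fS fy1; move: fy; rewrite fy1 ltxx.
by move=> [N _ CN]; exists N; apply: (CN N) => /=.
Qed.

End HemicompactOfEmbedding.

Lemma eberlein_grothendieck_hemicompact (X : topologicalType) (R : realType) :
  completely_regular_space X -> first_countable X ->
  eberlein_grothendieck R (weak_space (Ck X R)) -> hemicompact X.
Proof.
move=> crX fcX [K [_ cK [j embj]]].
have [[x _]|X0] := pselect (exists x : X, True); last first.
  have cX : compact [set: X].
    suff -> : [set: X] = set0 by exact: compact0.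
    by apply/seteqP; split => // x _; case: X0; exists x.
  by exists (fun=> setT); split => // C _; exists 0%N.
have [[k0 _]|K0] := pselect (exists k : K, True).
  exact: (@hemicompact_of_embedding X R K j k0).
have [jinj _ _] := embj.
have : (0 : Ck X R) = (@cst X R 1 : Ck X R).
  by apply: jinj; apply/continuousEP => k; case: K0; exists k.
move/(congr1 (fun f : Ck X R => f x)) => /eqP.
by rewrite eq_sym (_ : (0 : Ck X R) x = 0)// oner_eq0.
Qed.

Theorem theorem2p11 (R : realType) (X : topologicalType)
    (tychX : tychonoff_space X) (fcX : first_countable X) :
  [<-> hemicompact X;
       metrizable R (Ck X R);
       eberlein_grothendieck R (weak_space (Ck X R))].
Proof.
tfae.
- exact: hemicompact_metrizable.
- exact: metrizable_eberlein_grothendieck.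
- exact: (eberlein_grothendieck_hemicompact tychX.1 fcX).
Qed.
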